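(* For every composition $\alpha\vDash n$, \[ \mathfrak{L}_{\alpha}^* = \sum_{\beta \vDash n} K^{\mathfrak{L}}_{\alpha, \beta} M_{\beta},\] and the transition matrix from $\{M_\beta\}_{\beta\vDash n}$ to $\{\mathfrak{L}^*_\alpha\}_{\alpha\vDash n}$ (coefficients $K^{\mathfrak{L}}_{\alpha,\beta}\ge 0$) is unitriangular when compositions are arranged in lexicographic order.
   Context: A composition $\alpha \vDash n$ is a tuple of positive integers summing to $n$; its diagram has left-justified rows, row $i$ (from the bottom) having $\alpha_i$ cells. A word is a necklace word if it is lexicographically weakly smallest among all its cyclic shifts. A lexical tableau of shape $\alpha$ is a filling of the diagram of $\alpha$ with positive integers such that the first column strictly increases from the bottom row upward and every row read left to right is a necklace word; its type is the tuple $(\beta_1,\beta_2,\dots)$ where $\beta_i$ is the number of entries equal to $i$. $K^{\mathfrak{L}}_{\alpha,\beta}$ is the number of lexical tableaux of shape $\alpha$ and type $\beta$. For a lexical tableau $T$, $x^T=\prod_i x_i^{\#\{\text{entries of }T\text{ equal to }i\}}$. The dual lexical function is $\mathfrak{L}^*_\alpha=\sum_{T} x^T$, summed over all lexical tableaux $T$ of shape $\alpha$. The monomial quasisymmetric function is $M_\beta=\sum_{i_1<\cdots<i_{\ell(\beta)}} x_{i_1}^{\beta_1}\cdots x_{i_{\ell(\beta)}}^{\beta_{\ell(\beta)}}$. The lexicographic order compares compositions at the first index where they differ. *)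

(* Defs.v *)
From HB Require Import structures.
From mathcomp Require Import all_boot all_order all_algebra.
From mathcomp Require Import finmap multiset.
From mathcomp Require Import boolp classical_sets functions cardinality fsbigop.

Set Implicit Arguments.
Unset Strict Implicit.
Unset Printing Implicit Defensive.

Import Order.TTheory GRing.Theory Num.Theory.

Local Open Scope classical_set_scope.
Local Open Scope ring_scope.

Definition is_composition (n : nat) (s : seqlexi nat) : bool :=
  all (fun k => 0 < k)%N s && (sumn s == n).

(* Compositions of [n], ordered lexicographically as a subtype of             *)
(* [seqlexi nat]; no composition of [n] is a proper prefix of another one, so *)
(* this order is decided at the first index where two compositions differ.    *)
Record composition (n : nat) : predArgType := Composition {
  parts : seqlexi nat;
  partsP : is_composition n parts
}.

Definition seq_of_composition n (c : composition n) : seq nat := parts c.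
Coercion seq_of_composition : composition >-> seq.

Fact composition_display : Order.disp_t. Proof. exact: Order.Disp tt tt. Qed.

HB.instance Definition _ n := [isSub for @parts n].
HB.instance Definition _ n := [Countable of composition n by <:].
HB.instance Definition _ n :=
  [SubChoice_isSubOrder of composition n by <: with composition_display].

Fixpoint compositions_rec (fuel n : nat) : seq (seqlexi nat) :=
  if fuel is fuel'.+1 then
    (if n == 0%N then [:: [::]] else [::]) ++
    [seq k :: s | k <- iota 1 n, s <- compositions_rec fuel' (n - k)]
  else if n == 0%N then [:: [::]] else [::].

Lemma mem_compositions_rec fuel n (s : seqlexi nat) :
  (n <= fuel)%N -> is_composition n s -> s \in compositions_rec fuel n.
Proof.
elim: fuel n s => [|f IHf] n [|k s] /= lenf /andP[/= s_gt0 /eqP sumE].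
- by rewrite -sumE.
- by move: s_gt0 lenf; rewrite -sumE; case: k {sumE}.
- by rewrite -sumE.
- case/andP: s_gt0 => k_gt0 s_gt0; rewrite mem_cat; apply/orP; right.
  apply/allpairsPdep; exists k, s; split => //.
    by rewrite mem_iota k_gt0 add1n ltnS -sumE leq_addr.
  apply: IHf; last by rewrite /is_composition s_gt0 -sumE addKn /=.
  by move: k_gt0 lenf; rewrite -sumE addKn; case: k {sumE} => // k _;
    rewrite addSn ltnS; apply: leq_trans; rewrite leq_addl.
Qed.

Fact composition_enumP n :
  Finite.axiom (undup (pmap insub (compositions_rec n n) : seq (composition n))).
Proof.
apply: Finite.uniq_enumP; first exact: undup_uniq.
by move=> c; rewrite mem_undup mem_pmap_sub /= mem_compositions_rec ?partsP.
Qed.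

HB.instance Definition _ n := isFinite.Build (composition n) (@composition_enumP n).

Definition necklace (w : seqlexi nat) : Prop :=
  forall k : nat, (w <= (rot k w : seqlexi nat))%O.

(* A tableau is the sequence of its rows, from the bottom row upward. *)
Definition lexical_tableau (T : seq (seq nat)) : Prop :=
  [/\ all (all (fun a => 0 < a)%N) T,
      sorted ltn [seq head 0%N r | r <- T] &
      forall r, r \in T -> necklace r].

Definition lexical_tableaux (a : seq nat) : set (seq (seq nat)) :=
  [set T | lexical_tableau T /\ shape T = a].

(* [nth 0 b i] is the part [b_(i+1)]. *)
Definition has_type (T : seq (seq nat)) (b : seq nat) : Prop :=
  forall i : nat, count_mem i.+1 (flatten T) = nth 0%N b i.

(* [fset_set] is only meaningful on finite sets; here the entries of [T] are  *)
(* bounded by [size b], so the set is finite.                                 *)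
Definition lexical_kostka (a b : seq nat) : nat :=
  #|` fset_set (lexical_tableaux a `&` [set T | has_type T b]) |%fset.

(* Formal power series in x_1, x_2, ...: a monomial is encoded by the finite  *)
(* multiset of the indices of its variables, and a series by its              *)
(* coefficients. The variable x_0 never occurs.                               *)
Definition series : Type := {mset nat}%mset -> int^o.

HB.instance Definition _ := GRing.Lmodule.on series.

Definition monomial (m : {mset nat}%mset) : series := fun m' => (m' == m)%:R.

(* Formal infinite sums are taken coefficientwise; [\sum_(i \in A)] is the    *)
(* finitely supported sum, so this is meaningful when each monomial has a     *)
(* nonzero coefficient in only finitely many [F i].                           *)
Definition formal_sum (I : choiceType) (A : set I) (F : I -> series) : series :=
  fun m => \sum_(i \in A) F i m.

Definition tableau_monomial (T : seq (seq nat)) : series :=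
  monomial (seq_mset (flatten T)).

Definition dual_lexical (a : seq nat) : series :=
  formal_sum (lexical_tableaux a) tableau_monomial.

Definition monomial_qsym (b : seq nat) : series :=
  formal_sum
    [set s : seq nat |
      [/\ size s = size b, all (fun i => 0 < i)%N s & sorted ltn s]]
    (fun s => monomial
       (\big[msetD/mset0]_(k < size b) msetn (nth 0 b k) (nth 0 s k))%N).

Definition is_transition_mx (V : lmodType int) (N : nat)
    (F G : 'I_N -> V) (A : 'M[int]_N) : Prop :=
  forall i, G i = \sum_j A i j *: F j.

Definition lower_unitriangular (N : nat) (A : 'M[int]_N) : Prop :=
  is_trig_mx A /\ forall i, A i i = 1.

(* The compositions of [n] in increasing lexicographic order. *)
Definition nth_composition (n : nat) : 'I_#|composition n| -> composition n :=
  Order.enum_val.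

Definition lexical_kostka_mx (n : nat) : 'M[int]_#|composition n| :=
  \matrix_(i < #|composition n|, j < #|composition n|)
    (lexical_kostka (nth_composition i) (nth_composition j))%:Z.

(* Main.v *)
Require Import Defs.
From mathcomp Require Import all_boot all_order all_algebra.
From mathcomp Require Import finmap multiset.
From mathcomp Require Import boolp classical_sets functions cardinality fsbigop.

(* Expansion: a monomial with positive indices determines the increasing word *)
(* of its indices and the composition of its exponents, so it occurs in       *)
(* exactly one M_b, and relabelling the entries along the increasing          *)
(* bijection from 1, ..., l(b) onto that word preserves lexical tableaux.     *)
(* Unitriangularity: a necklace word starts with its smallest letter, so the  *)
(* first column being strictly increasing confines the 1s to the bottom row;  *)
(* hence b_1 <= a_1, with equality only if the bottom row is constant, and    *)
(* the comparison continues with the remaining rows.                          *)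

Set Implicit Arguments.
Unset Strict Implicit.
Unset Printing Implicit Defensive.

Import Order.TTheory GRing.Theory Num.Theory.

Local Open Scope classical_set_scope.
Local Open Scope ring_scope.

(** Both halves reduce to counting tableaux. For the expansion, coefficients of a fixed monomial [m]
    are compared. By [content_inj], [m] is [content c s] for at most one pair of a positive [c] and
    an increasing word [s], so at most one [monomial_qsym] contains [m], with coefficient 1.
    Order-preserving relabelling does not affect the conditions on a tableau, so the number of
    tableaux with monomial [m] depends on [c] only ([card_tableaux_with_content]); the word 1, 2,
    ... gives the Kostka number ([lexical_kostkaE]). For unitriangularity, [type_le_shape] peels off
    the bottom row and shows that a type never exceeds its shape lexicographically, with equality
    only for the tableau [constant_rows 0 a], whose i-th row is filled with i. *)

(* When [A `&` [set i | P i]] is infinite, both sides are the junk value [0]. *)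
Lemma fsum_indicator (I : choiceType) (A : set I) (P : pred I) :
  \sum_(i \in A) ((P i)%:R : int^o) =
  (#|` fset_set (A `&` [set i | P i])|%fset)%:Z.
Proof.
have suppE : A `&` (fun i => (P i)%:R : int^o) @^-1` [set~ 0] =
             A `&` [set i | P i].
  by apply/seteqP; split=> i /= [Ai]; case: (P i) => //= Pi; split.
case: finite_supportP => [|X _ _]; rewrite suppE => XE.
  by rewrite big_nil /fset_set; case: pselect.
rewrite -XE set_fsetK (eq_big_seq (fun=> 1)) => [|i iX].
  by elim: (X : seq I) => [|x s IHs]; rewrite ?big_nil // big_cons IHs /= intS.
by have [_ /= ->] : (A `&` [set i | P i]) i by rewrite -XE.
Qed.

(** Both cardinals are sums of the constant 1, and such sums reindex along a bijection without any
    finiteness assumption. *)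
Lemma card_fset_set_bij (I J : choiceType) (A : set I) (B : set J) (f : I -> J) :
  set_bij A B f -> #|` fset_set A|%fset = #|` fset_set B|%fset.
Proof.
move=> fbij; apply/eqP; rewrite -eqz_nat; apply/eqP.
have setE (K : choiceType) (C : set K) : C = C `&` [set i | xpredT i].
  by apply/seteqP; split=> i //= -[].
rewrite [A]setE [B]setE -!fsum_indicator.
by rewrite (reindex_fsbig f A B).
Qed.

(** * Necklace words and tableaux under increasing relabelling *)

Lemma seqlexi_mono_map (f : nat -> nat) (D : {pred nat}) (u v : seqlexi nat) :
  {in D &, {homo f : x y / (x < y)%N}} ->
  {subset u <= D} -> {subset v <= D} ->
  ((map f u : seqlexi nat) <= (map f v : seqlexi nat))%O = (u <= v)%O.
Proof.
move=> fD; have fmono := leq_mono_in fD.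
elim: u v => [|x u IHu] [|y v] //= uD vD.
have xD : x \in D by apply: uD; rewrite mem_head.
have yD : y \in D by apply: vD; rewrite mem_head.
rewrite !lexi_cons !leEnat !fmono // IHu // => z zu.
  by apply: uD; rewrite inE zu orbT.
by apply: vD; rewrite inE zu orbT.
Qed.

Lemma necklace_map (f : nat -> nat) (r : seq nat) :
  {in r &, {homo f : x y / (x < y)%N}} -> necklace r -> necklace (map f r).
Proof.
move=> fr rneck k; rewrite -map_rot.
by rewrite (@seqlexi_mono_map f (mem r)) // => x; rewrite mem_rot.
Qed.

(** Compare [r] with its rotation that starts at the first [x]. *)
Lemma necklace_head_le (r : seq nat) x :
  necklace r -> x \in r -> (head 0%N r <= x)%N.
Proof.
move=> rneck xr; move: (rneck (index x r)).
rewrite /rot (drop_index xr); case: r xr {rneck} => //= y r _.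
by rewrite lexi_cons leEnat => /andP[].
Qed.

Lemma necklace_nseq k x : necklace (nseq k x).
Proof.
move=> i; suff -> : rot i (nseq k x) = nseq k x by [].
have /all_pred1P -> : all (pred1 x) (rot i (nseq k x)).
  by apply/allP=> y; rewrite mem_rot mem_nseq => /andP[].
by rewrite size_rot size_nseq.
Qed.

Lemma lexical_tableaux_map (f : nat -> nat) (a : seq nat) T :
  all (fun k => 0 < k)%N a ->
  {in flatten T &, {homo f : x y / (x < y)%N}} ->
  {in flatten T, forall x, (0 < f x)%N} ->
  lexical_tableaux a T -> lexical_tableaux a (map (map f) T).
Proof.
move=> a_gt0 f_incr f_gt0 [[Tpos Thead Tneck] Tshape].
have inT r x : r \in T -> x \in r -> x \in flatten T.
  by move=> rT xr; apply/flattenP; exists r.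
(* Rows are nonempty, so [head] returns a genuine entry and not the default 0, on which [f] is not
   controlled. *)
have headT r : r \in T -> head 0%N r \in r.
  move=> rT; have : (0 < size r)%N.
    by apply: (allP a_gt0); rewrite -Tshape map_f.
  by case: r {rT} => //= x r _; rewrite mem_head.
split; last first.
  by rewrite -Tshape /shape -map_comp; apply: eq_map => r /=; rewrite size_map.
split.
- apply/allP => _ /mapP[r rT ->]; apply/allP => _ /mapP[x xr ->].
  exact/f_gt0/(inT r).
- have -> : [seq head 0%N r | r <- map (map f) T] =
            map f [seq head 0%N r | r <- T].
    rewrite -!map_comp; apply/eq_in_map => r rT /=.
    by have := headT r rT; case: r rT.
  apply: (homo_sorted_in f_incr) Thead.
  by apply/allP => _ /mapP[r rT ->]; exact/(inT r)/headT.
- move=> _ /mapP[r rT ->]; apply: necklace_map; last exact: Tneck.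
  by move=> x y xr yr; apply: f_incr; apply: (inT r).
Qed.

(** * Monomials as pairs of an exponent vector and an increasing word *)

(* The exponent vector of the monomial x_(s_1)^(b_1) x_(s_2)^(b_2) ... *)
Definition content (b s : seq nat) : {mset nat}%mset :=
  (\big[msetD/mset0]_(k < size b) msetn (nth 0 b k) (nth 0 s k))%N.

(** As the letters of [s] are distinct, at most one factor involves [x]. If [x] is not in [s], its
    index is [size b] and [nth] falls back to the exponent 0. *)
Lemma contentE (b s : seq nat) x : uniq s -> size s = size b ->
  content b s x = nth 0%N b (index x s).
Proof.
move=> s_uniq s_size.
have -> : content b s x =
    (\sum_(k < size b) if x == nth 0 s k then nth 0 b k else 0)%N.
  rewrite /content; elim/big_rec2: _ => [|k n m _ <-]; first by rewrite mset0E.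
  by rewrite msetE2 msetnE.
rewrite -big_mkcond /=; have [xs|xs] := boolP (x \in s); last first.
  rewrite nth_default ?big1 //; last first.
    by rewrite leqNgt -s_size index_mem.
  move=> k /eqP xE; case/negP: xs; rewrite xE mem_nth // s_size.
  exact: ltn_ord.
have ltk : (index x s < size b)%N by rewrite -s_size index_mem.
rewrite (big_pred1 (Ordinal ltk)) // => k /=.
rewrite -[x in LHS](nth_index 0%N xs) nth_uniq ?index_mem ?s_size //.
by rewrite eq_sym.
Qed.

Definition increasing_word (b : seq nat) : set (seq nat) :=
  [set s : seq nat |
      [/\ size s = size b, all (fun i => 0 < i)%N s & sorted ltn s]].

Lemma increasing_word_uniq b s : increasing_word b s -> uniq s.
Proof. by case=> _ _; apply/sorted_uniq; [exact: ltn_trans | exact: ltnn]. Qed.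

Lemma iota_increasing_word b : increasing_word b (iota 1 (size b)).
Proof.
split; rewrite ?size_iota ?iota_ltn_sorted //.
by apply/allP => i; rewrite mem_iota => /andP[].
Qed.

Lemma mem_content b s x : increasing_word b s -> all (fun k => 0 < k)%N b ->
  (0 < content b s x)%N = (x \in s).
Proof.
move=> sP b_gt0; have [s_size _ _] := sP.
rewrite contentE ?(increasing_word_uniq sP) // -index_mem s_size.
have [ltb|leb] := ltnP (index x s) (size b); last by rewrite nth_default.
by apply: (allP b_gt0); rewrite mem_nth.
Qed.

(** Exponents being positive, the support of the monomial is the set of letters, which determines
    the increasing word; the multiplicities along it then give the exponents. *)
Lemma content_inj b c s t :
  increasing_word b s -> increasing_word c t ->
  all (fun k => 0 < k)%N b -> all (fun k => 0 < k)%N c ->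
  content b s = content c t -> b = c /\ s = t.
Proof.
move=> sP tP b_gt0 c_gt0 bsct.
have st : s = t.
  have [_ _ s_sorted] := sP; have [_ _ t_sorted] := tP.
  apply: (irr_sorted_eq ltn_trans ltnn) => // x.
  by rewrite -(mem_content x sP) // bsct mem_content.
subst t; split=> //; have s_uniq := increasing_word_uniq sP.
have [sb _ _] := sP; have [sc _ _] := tP.
apply: (@eq_from_nth _ 0%N) => [|i ib]; first by rewrite -sb.
have := congr1 (fun m : {mset nat}%mset => m (nth 0%N s i)) bsct.
by rewrite !contentE // index_uniq // sb.
Qed.

Lemma seq_mset_content (w : seq nat) : all (fun x => 0 < x)%N w ->
  exists b s, [/\ all (fun k => 0 < k)%N b, sumn b = size w,
                  increasing_word b s & seq_mset w = content b s].
Proof.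
move=> w_gt0; pose s := sort leq (undup w).
have s_uniq : uniq s by rewrite sort_uniq undup_uniq.
have mem_s : s =i w by move=> x; rewrite mem_sort mem_undup.
exists [seq count_mem x w | x <- s], s; split.
- by apply/allP => _ /mapP[x xs ->]; rewrite -has_count has_pred1 -mem_s.
- rewrite sumnE big_map (perm_big _ (permEl (perm_sort leq (undup w)))) /=.
  (* The length of [w] is a sum of ones, grouped by distinct letter. *)
  rewrite -[RHS]sum1_size -[RHS]big_undup_iterop_count; apply: eq_bigr => x _.
  by rewrite Monoid.iteropE iter_addn_0 mul1n.
- split; first by rewrite size_map.
    by apply/allP => x; rewrite mem_s; apply: (allP w_gt0).
  by rewrite ltn_sorted_uniq_leq s_uniq sort_sorted //; apply: leq_total.
apply/msetP => x; rewrite mset_seqE contentE ?size_map //.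
have [xs|xs] := boolP (x \in s).
  by rewrite (nth_map 0%N) ?index_mem // nth_index.
rewrite nth_default ?size_map; last by rewrite leqNgt index_mem.
by apply/eqP; rewrite -leqn0 leqNgt -has_count has_pred1 -mem_s.
Qed.

(** * Transport of tableaux from one increasing word to another *)

Definition transfer (s t : seq nat) (x : nat) : nat := nth 0%N t (index x s).

Definition tableaux_with_content (a b s : seq nat) : set (seq (seq nat)) :=
  lexical_tableaux a `&` [set T | content b s == seq_mset (flatten T)].

Lemma mem_tableau_content a b s T x : increasing_word b s ->
  tableaux_with_content a b s T -> x \in flatten T -> x \in s.
Proof.
move=> sP [_ /= /eqP cE]; rewrite -has_pred1 has_count -mset_seqE -cE.
have [s_size _ _] := sP.
rewrite contentE ?(increasing_word_uniq sP) // -index_mem s_size.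
by have [//|leb] := ltnP (index x s) (size b); rewrite nth_default.
Qed.

Lemma transfer_incr b s t : increasing_word b s -> increasing_word b t ->
  {in s &, {homo transfer s t : x y / (x < y)%N}}.
Proof.
move=> [sb _ ss] [tb _ tt] x y xs ys xy.
apply: (sorted_ltn_nth ltn_trans) => //.
- by rewrite inE tb -sb index_mem.
- by rewrite inE tb -sb index_mem.
(* Contrapositive: positions in a weakly wrong order would give letters of [s] in a weakly wrong
   order. *)
rewrite ltnNge; apply: contraTN xy => yx; rewrite -leqNgt.
have leqs : sorted leq s by move: ss; rewrite ltn_sorted_uniq_leq => /andP[].
rewrite -[x](nth_index 0%N xs) -[y](nth_index 0%N ys).
by apply: (sorted_leq_nth leq_trans leqnn) => //; rewrite inE index_mem.
Qed.

Lemma transferK b s t : increasing_word b s -> increasing_word b t ->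
  {in s, cancel (transfer s t) (transfer t s)}.
Proof.
move=> [sb _ _] tP x xs; have [tb _ _] := tP.
rewrite /transfer index_uniq ?nth_index ?(increasing_word_uniq tP) //.
by rewrite tb -sb index_mem.
Qed.

Lemma transfer_tableau a b s t T :
  all (fun k => 0 < k)%N a -> increasing_word b s -> increasing_word b t ->
  tableaux_with_content a b s T ->
  tableaux_with_content a b t (map (map (transfer s t)) T).
Proof.
move=> a_gt0 sP tP TP; have memT := mem_tableau_content sP TP.
have mem_tr x : x \in s -> transfer s t x \in t.
  have [sb _ _] := sP; have [tb _ _] := tP.
  by move=> xs; rewrite mem_nth // tb -sb index_mem.
have [tb t_gt0 _] := tP; have [sb _ _] := sP.
split.
  apply: lexical_tableaux_map => //; last by case: TP.
    by move=> x y /memT xs /memT ys; apply: (transfer_incr sP tP).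
  by move=> x /memT /mem_tr; apply: (allP t_gt0).
apply/eqP/msetP => y; rewrite mset_seqE -map_flatten.
have [yt|yt] := boolP (y \in t); last first.
  rewrite contentE ?(increasing_word_uniq tP) // nth_default; last first.
    by rewrite -tb leqNgt index_mem.
  apply/esym/eqP; rewrite -leqn0 leqNgt -has_count has_pred1.
  by apply: contra yt => /mapP[x /memT /mem_tr + ->].
(* The copies of [y] after relabelling are exactly the images of the copies of [x], because
   [transfer s t] is injective on [s]. *)
pose x := transfer t s y.
have yE : transfer s t x = y by apply: (transferK tP sP).
have xs : x \in s by rewrite mem_nth // sb -tb index_mem.
rewrite count_map (eq_in_count (a2 := pred1 x)) => [|z /memT zs /=]; last first.
  apply/eqP/eqP => [zE|->//].
  by rewrite -(transferK sP tP zs) zE.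
have [_ /= /eqP cE] := TP.
rewrite -mset_seqE -cE !contentE ?(increasing_word_uniq tP) //; last first.
  exact: increasing_word_uniq sP.
by rewrite /x /transfer index_uniq ?(increasing_word_uniq sP) // sb -tb index_mem.
Qed.

Lemma transfer_tableauK a b s t T :
  increasing_word b s -> increasing_word b t -> tableaux_with_content a b s T ->
  map (map (transfer t s)) (map (map (transfer s t)) T) = T.
Proof.
move=> sP tP TP; rewrite -map_comp -[RHS]map_id; apply/eq_in_map => r rT /=.
rewrite -map_comp -[RHS]map_id; apply/eq_in_map => x xr /=.
apply: (transferK sP tP); apply: (mem_tableau_content sP TP).
by apply/flattenP; exists r.
Qed.

(** This is the quasisymmetry of [dual_lexical a]: [transfer s t] and [transfer t s] are inverse
    bijections between the two sets of tableaux. *)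
Lemma card_tableaux_with_content a b s t :
  all (fun k => 0 < k)%N a -> increasing_word b s -> increasing_word b t ->
  #|` fset_set (tableaux_with_content a b s)|%fset =
  #|` fset_set (tableaux_with_content a b t)|%fset.
Proof.
move=> a_gt0 sP tP.
apply: (@card_fset_set_bij _ _ _ _ (map (map (transfer s t)))); split.
- by move=> T TP; apply: transfer_tableau.
- move=> T U /set_mem TP /set_mem UP TU.
  by rewrite -(transfer_tableauK sP tP TP) TU (transfer_tableauK sP tP UP).
- move=> T TP; exists (map (map (transfer t s)) T).
    exact: transfer_tableau.
  exact: (transfer_tableauK tP sP TP).
Qed.

(** * Kostka numbers as coefficients, and the monomial expansion *)

Lemma has_type_content a b T : lexical_tableaux a T ->
  has_type T b <-> content b (iota 1 (size b)) = seq_mset (flatten T).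
Proof.
move=> [[Tpos _ _] _].
have indexS i : nth 0%N b (index i.+1 (iota 1 (size b))) = nth 0%N b i.
  have [ib|bi] := ltnP i (size b).
    rewrite -[i.+1]/(1 + i)%N -(nth_iota 0%N 1 ib).
    by rewrite index_uniq ?size_iota ?iota_uniq.
  rewrite !nth_default // leqNgt -[X in (_ < X)%N](size_iota 1) index_mem mem_iota.
  by rewrite add1n ltnS -ltnNge.
split=> [Tb|bT i].
  apply/msetP => -[|i]; rewrite contentE ?iota_uniq ?size_iota // mset_seqE.
    (* Multiplicity of 0: [has_type] says nothing about it, but entries are positive. *)
    rewrite nth_default; last first.
      by rewrite leqNgt -[X in (_ < X)%N](size_iota 1) index_mem mem_iota.
    apply/esym/eqP; rewrite -leqn0 leqNgt -has_count has_pred1.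
    apply/negP => /flattenP[r rT r0].
    by have := allP (allP Tpos r rT) _ r0.
  by rewrite indexS Tb.
by rewrite -mset_seqE -bT contentE ?iota_uniq ?size_iota.
Qed.

Lemma lexical_kostkaE a b s : all (fun k => 0 < k)%N a -> increasing_word b s ->
  lexical_kostka a b = #|` fset_set (tableaux_with_content a b s)|%fset.
Proof.
move=> a_gt0 sP.
rewrite (card_tableaux_with_content a_gt0 sP (@iota_increasing_word b)).
rewrite /lexical_kostka; congr (#|` fset_set _|%fset).
apply/seteqP; split=> T [TP /=].
  by move/(has_type_content b TP) => E; split=> //=; apply/eqP.
by move=> /eqP E; split=> //=; apply/(has_type_content b TP).
Qed.

Lemma dual_lexicalE a m :
  dual_lexical a m =
  (#|` fset_set (lexical_tableaux a `&`
       [set T | m == seq_mset (flatten T)])|%fset)%:Z.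
Proof. exact: fsum_indicator. Qed.

Lemma monomial_qsymE b m :
  monomial_qsym b m =
  (#|` fset_set (increasing_word b `&` [set s | m == content b s])|%fset)%:Z.
Proof. exact: fsum_indicator. Qed.

Lemma composition_gt0 n (c : composition n) : all (fun k => 0 < k)%N c.
Proof. by case/andP: (partsP c). Qed.

Lemma composition_sumn n (c : composition n) : sumn c = n.
Proof. by case/andP: (partsP c) => _ /eqP. Qed.

Lemma composition_inj n (b c : composition n) : b = c :> seq nat -> b = c.
Proof. exact: val_inj. Qed.

Lemma dual_lexical_monomial n (a : composition n) :
  dual_lexical a =
  \sum_(b : composition n) (lexical_kostka a b)%:Z *: monomial_qsym b.
Proof.
apply/funext => m; rewrite dual_lexicalE.
have -> : (\sum_(b : composition n) (lexical_kostka a b)%:Z *: monomial_qsym b) m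
   = \sum_(b : composition n) (lexical_kostka a b)%:Z * (monomial_qsym b m : int).
  by elim/big_rec2: _ => // b x y _ <-.
(* Either [m] occurs in the quasisymmetric function of a composition [c] of [n], and only the
   summand of [c] survives, or both sides vanish at [m]. *)
have [[c [s [sP mE]]]|noc] := pselect (exists (c : composition n) s,
  increasing_word c s /\ m = content c s).
  rewrite (bigD1 c) //= big1 => [|b bc].
    rewrite addr0 (lexical_kostkaE (composition_gt0 a) sP) monomial_qsymE.
    have -> : increasing_word c `&` [set s | m == content c s] = [set s].
      apply/seteqP; split=> [t [tP /= /eqP mt]|t ->]; last by split; rewrite //= mE.
      rewrite mE in mt.
      by have [] := content_inj tP sP (composition_gt0 c) (composition_gt0 c) (esym mt).
    by rewrite fset_set1 cardfs1 mulr1 /tableaux_with_content mE.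
  rewrite monomial_qsymE (_ : _ `&` _ = set0) ?fset_set0 ?cardfs0 ?mulr0 //.
  rewrite -subset0 => t [tP /= /eqP mt]; case/negP: bc; apply/eqP/composition_inj.
  rewrite mE in mt.
  by have [] := content_inj tP sP (composition_gt0 b) (composition_gt0 c) (esym mt).
rewrite big1 => [|b _].
  rewrite (_ : _ `&` _ = set0) ?fset_set0 ?cardfs0 //.
  rewrite -subset0 => T [[[Tpos _ _] Tshape] /= /eqP mT]; apply: noc.
  (* A tableau with monomial [m] would write [m] as a content whose exponents sum to the number of
     cells, namely [n]. *)
  have [|b [s [b_gt0 bT sP TE]]] := @seq_mset_content (flatten T).
    by apply/allP => x /flattenP[r rT]; apply: (allP (allP Tpos r rT)).
  have bP : is_composition n b.
    by rewrite /is_composition b_gt0 bT size_flatten Tshape composition_sumn /=.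
  by exists (Composition bP), s; rewrite mT.
rewrite monomial_qsymE (_ : _ `&` _ = set0) ?fset_set0 ?cardfs0 ?mulr0 //.
by rewrite -subset0 => t [tP /= /eqP mt]; apply: noc; exists b, t.
Qed.

(** * Unitriangularity: type against shape *)

Fixpoint constant_rows (c : nat) (a : seq nat) : seq (seq nat) :=
  if a is k :: a' then nseq k c.+1 :: constant_rows c.+1 a' else [::].

(** Induction on the rows, where [c] counts the letters already used up. Later rows start above
    [c.+1] and heads are minimal, so [c.+1] occurs in the first row only and the first part of [b]
    is at most the length of that row. A strict inequality settles the comparison; equality makes
    the row constant, and the remaining rows satisfy the hypotheses for [c.+1]. *)
Lemma type_le_shape (c : nat) (b : seqlexi nat) (T : seq (seq nat)) :
  all (fun k => 0 < k)%N b -> all (fun k => 0 < k)%N (shape T) ->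
  sorted ltn [seq head 0%N r | r <- T] ->
  (forall r x, r \in T -> x \in r -> (head 0%N r <= x)%N) ->
  (forall r x, r \in T -> x \in r -> (c < x)%N) ->
  (forall i, count_mem (c + i).+1 (flatten T) = nth 0%N b i) ->
  (b <= (shape T : seqlexi nat))%O /\
  (b = shape T -> T = constant_rows c b).
Proof.
elim: T b c => [|r T IH] [|k b] c //=.
  (* Without rows every count is 0, contradicting a positive first part [k]. *)
  by move=> /andP[k0 _] _ _ _ _ /(_ 0%N) /= E; rewrite -E in k0.
move=> /andP[k_gt0 b_gt0] /andP[r_gt0 T_gt0] Thead Tmin Tc Tb.
have head_r : head 0%N r \in r.
  by case: r r_gt0 {Thead Tmin Tc Tb} => // x r; rewrite mem_head.
have Tc1 r' x : r' \in T -> x \in r' -> (c.+1 < x)%N.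
  move=> r'T xr'; apply: (@leq_ltn_trans (head 0%N r)).
    by apply: (Tc r) => //; rewrite mem_head.
  apply: (@leq_trans (head 0%N r')).
    move: Thead; rewrite path_sortedE; last exact: ltn_trans.
    by case/andP=> /allP + _; apply; apply: map_f.
  by apply: Tmin xr'; rewrite inE r'T orbT.
have noc : count_mem c.+1 (flatten T) = 0%N.
  apply/eqP; rewrite -leqn0 leqNgt -has_count has_pred1.
  by apply/negP => /flattenP[r' /Tc1 r'c /r'c]; rewrite ltnn.
have kE : count_mem c.+1 r = k.
  by have := Tb 0%N; rewrite /= addn0 count_cat noc addn0.
have ler : (k <= size r)%N by rewrite -kE count_size.
rewrite lexi_cons leEnat ler /=.
have [ltr|ger] := ltnP k (size r).
  by split=> // -[kr _]; rewrite kr ltnn in ltr.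
have rE : r = nseq k c.+1.
  have kr : k = size r by apply/eqP; rewrite eqn_leq ler.
  by rewrite kr; apply/all_pred1P; rewrite all_count kE kr.
have [||||bT TE] := IH b c.+1 b_gt0 T_gt0.
- exact: path_sorted Thead.
- by move=> r' x r'T; apply: Tmin; rewrite inE r'T orbT.
- exact: Tc1.
- move=> i; have := Tb i.+1; rewrite /= count_cat (addSnnS c i) => <-.
  (* The first row contains only [c.+1], so it contributes nothing to the counts of larger
     letters. *)
  have -> : count_mem (c + i.+1).+1 r = 0%N; last by rewrite add0n.
  by rewrite rE count_nseq /= eqSS -{1}[c]addn0 eqn_add2l mul0n.
split; first exact: bT.
by case=> _ /TE <-; rewrite rE.
Qed.

Lemma lexical_tableau_type_le a b T :
  all (fun k => 0 < k)%N a -> all (fun k => 0 < k)%N b ->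
  lexical_tableaux a T -> has_type T b ->
  ((b : seqlexi nat) <= (a : seqlexi nat))%O /\ (b = a -> T = constant_rows 0 b).
Proof.
move=> a_gt0 b_gt0 [[Tpos Thead Tneck] Tshape] Tb; rewrite -Tshape in a_gt0 *.
apply: type_le_shape => //.
  by move=> r x /Tneck rneck; apply: necklace_head_le.
by move=> r x rT; apply: (allP (allP Tpos r rT)).
Qed.

Lemma shape_constant_rows c a : shape (constant_rows c a) = a.
Proof. by elim: a c => //= k a IHa c; rewrite size_nseq IHa. Qed.

Lemma head_constant_rows c a : all (fun k => 0 < k)%N a ->
  [seq head 0%N r | r <- constant_rows c a] = iota c.+1 (size a).
Proof.
elim: a c => //= k a IHa c /andP[k_gt0 a_gt0]; rewrite IHa //.
by case: k k_gt0.
Qed.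

Lemma mem_constant_rows c a r : r \in constant_rows c a ->
  exists k x, (c < x)%N /\ r = nseq k x.
Proof.
elim: a c => //= k a IHa c; rewrite inE => /orP[/eqP ->|/IHa[l [x [cx ->]]]].
  by exists k, c.+1.
by exists l, x; split=> //; apply: ltnW.
Qed.

Lemma count_constant_rows c a i :
  count_mem (c + i).+1 (flatten (constant_rows c a)) = nth 0%N a i.
Proof.
elim: a c i => [|k a IHa] c [|i] //=; rewrite count_cat count_nseq /=.
  rewrite addn0 eqxx mul1n -[RHS]addn0; congr addn.
  apply/eqP; rewrite -leqn0 leqNgt -has_count has_pred1; apply/negP.
  move=> /flattenP[r /mem_constant_rows[l [x [cx ->]]]].
  by rewrite mem_nseq => /andP[_ /eqP xE]; rewrite xE ltnn in cx.
by rewrite eqSS -{1}[c]addn0 eqn_add2l /= mul0n add0n -addSnnS IHa.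
Qed.

Lemma constant_rows_lexical a : all (fun k => 0 < k)%N a ->
  lexical_tableaux a (constant_rows 0 a).
Proof.
move=> a_gt0; split; last exact: shape_constant_rows.
split.
- apply/allP => r /mem_constant_rows[k [x [x_gt0 ->]]].
  by rewrite all_nseq x_gt0 orbT.
- by rewrite head_constant_rows // iota_ltn_sorted.
- by move=> r /mem_constant_rows[k [x [_ ->]]]; apply: necklace_nseq.
Qed.

(** * Entries of the transition matrix *)

Lemma lexical_kostka_eq0 n (a b : composition n) :
  (a < b)%O -> lexical_kostka a b = 0%N.
Proof.
move=> ab; rewrite /lexical_kostka (_ : _ `&` _ = set0) ?fset_set0 ?cardfs0 //.
rewrite -subset0 => T [TP /= Tb].
have [ba _] :=
  lexical_tableau_type_le (composition_gt0 a) (composition_gt0 b) TP Tb.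
suff : (b <= a)%O by rewrite leNgt ab.
exact: ba.
Qed.

Lemma lexical_kostka_diag n (a : composition n) : lexical_kostka a a = 1%N.
Proof.
rewrite /lexical_kostka (_ : _ `&` _ = [set constant_rows 0 a]).
  by rewrite fset_set1 cardfs1.
have a_gt0 := composition_gt0 a.
apply/seteqP; split=> [T [TP /= Ta]|_ ->].
  by have [_ ->] := lexical_tableau_type_le a_gt0 a_gt0 TP Ta.
split; first exact: constant_rows_lexical.
by move=> i; rewrite -(count_constant_rows 0 a i) add0n.
Qed.

Theorem theorem4p2 (n : nat) :
  (forall a : composition n,
     dual_lexical a =
     \sum_(b : composition n) (lexical_kostka a b)%:Z *: monomial_qsym b) /\
  [/\ is_transition_mx (fun j => monomial_qsym (nth_composition j))
        (fun i => dual_lexical (nth_composition i)) (lexical_kostka_mx n),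
      forall i j, 0 <= lexical_kostka_mx n i j &
      lower_unitriangular (lexical_kostka_mx n)].
Proof.
split; first exact: dual_lexical_monomial.
split.
- move=> i; rewrite dual_lexical_monomial.
  rewrite (reindex (@nth_composition n)) /=.
    by apply: eq_bigr => j _; rewrite mxE.
  exact/onW_bij/Order.EnumVal.enum_val_bij.
- by move=> i j; rewrite mxE.
- split; last by move=> i; rewrite mxE lexical_kostka_diag.
  apply/is_trig_mxP => i j ij; rewrite mxE lexical_kostka_eq0 //.
  (* [enum_val] lists compositions increasingly, so [i < j] as indices gives the strict order that
     [lexical_kostka_eq0] requires. *)
  rewrite ltNge /nth_composition Order.le_enum_val; first by rewrite -ltnNge.
  exact: le_total.
Qed.
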